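(* Let $\mathcal R$ be a left-linear infinitary first-order term rewriting system with rewriting relation $\to$. Then $\to$ satisfies property $Q$: for every ordinal $\delta$ and all $s,t,t'\in T^\infty$, if $P_\delta$ holds and $s\twoheadrightarrow_\delta t\to t'$, then there is $s'\in T^\infty$ with $s\to^*s'\twoheadrightarrow_\delta t'$.
   Context: Fix a countable set $\mathrm{Var}$ of variables and a countable signature $\Sigma$ with arity function $\mathrm{ar}$. $T$ is the set of finite first-order terms and $T^\infty$ the set of possibly infinite ones (coinductively: a variable or $f(s_1,\dots,s_{\mathrm{ar}(f)})$). Substitutions $\sigma:\mathrm{Var}\to T^\infty$ act coinductively: $\sigma\cdot x=\sigma(x)$, $\sigma\cdot f(s_1,\dots,s_k)=f(\sigma\cdot s_1,\dots,\sigma\cdot s_k)$. A rewrite rule is $(l,r)\in T\times T^\infty$ with $l$ not a variable and variables of $r$ occurring in $l$; it is left-linear if no variable occurs twice in $l$. An infinitary term rewriting system $\mathcal R$ is a set of rewrite rules; it is left-linear if all its rules are. Its rewriting relation $\to$: $\sigma\cdot l\to\sigma\cdot r$ for $(l,r)\in\mathcal R$ and any $\sigma$; $f(\dots,s_i,\dots)\to f(\dots,s_i',\dots)$ if $s_i\to s_i'$. $\to^*$ is its reflexive transitive closure. For every ordinal $\gamma$ (by well-founded induction), relations $\twoheadrightarrow_\gamma$, $\overline{\twoheadrightarrow}_\gamma$ on $T^\infty$: (split) $s\twoheadrightarrow_\gamma t$ if there are $m\in\mathbb N$, $s'$ with $s\rightsquigarrow^\gamma_ms'$ and $s'\,\overline{\twoheadrightarrow}_\gamma\,t$,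 where $s\rightsquigarrow^\gamma_ms'$ means there are ordinals $\delta_1,\dots,\delta_m<\gamma$ and terms with $s\to^*s_1'\,\overline{\twoheadrightarrow}_{\delta_1}\,t_1\to^*\cdots\overline{\twoheadrightarrow}_{\delta_m}\,t_m\to^*s'$ (for $m=0$: $s\to^*s'$); (lift$_x$) $x\,\overline{\twoheadrightarrow}_\gamma\,x$; (lift$_f$) $f(s_1,\dots,s_k)\,\overline{\twoheadrightarrow}_\gamma\,f(s_1',\dots,s_k')$ if $s_i\twoheadrightarrow_\gamma s_i'$ for all $i$, premisses coinductive. Derivations may be non-wellfounded provided every infinite branch crosses infinitely many coinductive premisses. Property $P_\delta$: for all $n\in\mathbb N$ and $s,s'$, if $s\rightsquigarrow^\delta_ns'$ then there are $s''$ and $\epsilon<\delta$ with $s\to^*s''$ and $s''\,(\overline{\twoheadrightarrow}_\epsilon)^*\,s'$ ($(\cdot)^*$ = reflexive transitive closure). *)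

(* Defs.v *)
From mathcomp Require Import all_boot.

Set Implicit Arguments.
Unset Strict Implicit.
Unset Printing Implicit Defensive.

(** ** Possibly infinite terms *)

CoInductive term (V S : countType) (ar : S -> nat) : Type :=
| TVar (x : V)
| TFun (f : S) (a : 'I_(ar f) -> term V ar).

Arguments TVar {V S ar} x.
Arguments TFun {V S ar} f a.

(** Leibniz equality on a coinductive type is strictly finer than equality of
    infinite trees, which is bisimilarity. [step] and [star] therefore mention
    [teq], so that they and the relations built from them are stable under
    it. *)
CoInductive teq (V S : countType) (ar : S -> nat) :
  term V ar -> term V ar -> Prop :=
| teq_var (x : V) : teq (TVar x) (TVar x)
| teq_fun (f : S) (a b : 'I_(ar f) -> term V ar) :
    (forall i, teq (a i) (b i)) -> teq (TFun f a) (TFun f b).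

Inductive finite_term (V S : countType) (ar : S -> nat) : term V ar -> Prop :=
| finite_var (x : V) : finite_term (TVar x)
| finite_fun (f : S) (a : 'I_(ar f) -> term V ar) :
    (forall i, finite_term (a i)) -> finite_term (TFun f a).

CoFixpoint subst (V S : countType) (ar : S -> nat) (sigma : V -> term V ar)
    (t : term V ar) : term V ar :=
  match t with
  | TVar x => sigma x
  | TFun f a => TFun f (fun i => subst sigma (a i))
  end.

(** [var_at t p x]: the variable [x] stands at position [p] of [t]. *)
Inductive var_at (V S : countType) (ar : S -> nat) :
  term V ar -> seq nat -> V -> Prop :=
| var_at_var (x : V) : var_at (TVar x) [::] x
| var_at_fun (f : S) (a : 'I_(ar f) -> term V ar) (i : 'I_(ar f))
    (p : seq nat) (x : V) :
    var_at (a i) p x -> var_at (TFun f a) (nat_of_ord i :: p) x.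

Definition occurs (V S : countType) (ar : S -> nat) (x : V) (t : term V ar) :
  Prop := exists p, var_at t p x.

Definition linear_term (V S : countType) (ar : S -> nat) (t : term V ar) :
  Prop := forall x p q, var_at t p x -> var_at t q x -> p = q.

(** ** Rewriting *)

Record rule (V S : countType) (ar : S -> nat) : Type := Rule {
  lhs : term V ar;
  rhs : term V ar;
  lhs_finite : finite_term lhs;
  lhs_not_var : forall x : V, lhs <> TVar x;
  rhs_vars : forall x : V, occurs x rhs -> occurs x lhs
}.

Definition trs (V S : countType) (ar : S -> nat) : Type := rule V ar -> Prop.

Definition left_linear (V S : countType) (ar : S -> nat) (R : trs V ar) :
  Prop := forall rho, R rho -> linear_term (lhs rho).

Inductive step (V S : countType) (ar : S -> nat) (R : trs V ar) :
  term V ar -> term V ar -> Prop :=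
| step_root (rho : rule V ar) (sigma : V -> term V ar) (s t : term V ar) :
    R rho -> teq s (subst sigma (lhs rho)) -> teq t (subst sigma (rhs rho)) ->
    step R s t
| step_arg (f : S) (a b : 'I_(ar f) -> term V ar) (i : 'I_(ar f)) :
    step R (a i) (b i) -> (forall j, j != i -> teq (a j) (b j)) ->
    step R (TFun f a) (TFun f b).

Inductive star (V S : countType) (ar : S -> nat)
    (red : term V ar -> term V ar -> Prop) : term V ar -> term V ar -> Prop :=
| star_refl (s t : term V ar) : teq s t -> star red s t
| star_step (s t u : term V ar) : red s t -> star red t u -> star red s u.

(** ** Ordinals *)

(** Ordinals are represented as elements of arbitrary well-ordered types: an
    ordinal [delta] is an element of the well-order [delta + 1], and the
    relations indexed by [delta] only depend on the initial segment below it. *)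
Record well_order (W : Type) (lt : W -> W -> Prop) : Prop := WellOrder {
  wo_wf : well_founded lt;
  wo_trans : forall a b c, lt a b -> lt b c -> lt a c;
  wo_total : forall a b, [\/ lt a b, a = b | lt b a]
}.

(** ** Transfinite reduction *)

(** [chain red lt L gamma m s s'] is the relation [s ~>^gamma_m s'], where
    [L delta] stands for the overlined relation at [delta]. *)
Inductive chain (V S : countType) (ar : S -> nat)
    (red : term V ar -> term V ar -> Prop) (W : Type) (lt : W -> W -> Prop)
    (L : W -> term V ar -> term V ar -> Prop) (gamma : W) :
  nat -> term V ar -> term V ar -> Prop :=
| chain_0 (s s' : term V ar) : star red s s' -> chain red lt L gamma 0 s s'
| chain_S (m : nat) (delta : W) (s s1 t1 s' : term V ar) :
    lt delta gamma -> star red s s1 -> L delta s1 t1 ->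
    chain red lt L gamma m t1 s' -> chain red lt L gamma m.+1 s s'.

(** The rule (split), over a given family [L] of overlined relations. *)
Inductive split_by (V S : countType) (ar : S -> nat)
    (red : term V ar -> term V ar -> Prop) (W : Type) (lt : W -> W -> Prop)
    (L : W -> term V ar -> term V ar -> Prop) (gamma : W)
    (s t : term V ar) : Prop :=
| split (m : nat) (s' : term V ar) :
    chain red lt L gamma m s s' -> L gamma s' t ->
    split_by red lt L gamma s t.

(** The overlined relations, for all ordinals at once. The inductive [split_by]
    is nested inside the coinductive [lift], so (split) is used finitely often
    between two crossings of premisses of (lift_f). As every derivation in
    [lift delta], [delta < gamma], is itself built by the lift rules, and [lt]
    is well-founded, this is the family obtained by taking at each [gamma] the
    greatest fixed point relative to the relations already given below
    [gamma]. *)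
CoInductive lift (V S : countType) (ar : S -> nat)
    (red : term V ar -> term V ar -> Prop) (W : Type) (lt : W -> W -> Prop) :
  W -> term V ar -> term V ar -> Prop :=
| lift_var (gamma : W) (x : V) : lift red lt gamma (TVar x) (TVar x)
| lift_fun (gamma : W) (f : S) (a b : 'I_(ar f) -> term V ar) :
    (forall i, split_by red lt (lift red lt) gamma (a i) (b i)) ->
    lift red lt gamma (TFun f a) (TFun f b).

Definition mred (V S : countType) (ar : S -> nat)
    (red : term V ar -> term V ar -> Prop) (W : Type) (lt : W -> W -> Prop)
    (gamma : W) : term V ar -> term V ar -> Prop :=
  split_by red lt (lift red lt) gamma.

Definition property_P (V S : countType) (ar : S -> nat)
    (red : term V ar -> term V ar -> Prop) (W : Type) (lt : W -> W -> Prop)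
    (delta : W) : Prop :=
  forall (n : nat) (s s' : term V ar),
    chain red lt (lift red lt) delta n s s' ->
    exists (s'' : term V ar) (epsilon : W),
      [/\ lt epsilon delta, star red s s'' &
          star (lift red lt epsilon) s'' s'].

(* Main.v *)
Require Import Defs.
From mathcomp Require Import all_boot.

Set Implicit Arguments.
Unset Strict Implicit.
Unset Printing Implicit Defensive.

(** If [s] reduces to [f(a_1,...,a_k)] by [->>_delta], then [P_delta] replaces
    the chain before the last lift by a finite reduction [s ->* s''] followed by
    lifts at some [epsilon < delta]. Lifts preserve the root, so
    [s'' = f(v_1,...,v_k)], and the lifts below the root are absorbed in
    [v_i ->>_delta a_i]. Iterating this along the path to the contracted redex
    and then along the finite left-hand side [l] exposes, after finitely many
    steps from [s], an instance [sigma' l] with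
    [sigma' x ->>_delta sigma x]; linearity of [l] makes the substitutions found
    in the different arguments compatible. It remains to contract this redex. *)

Section Terms.
Variables (V S : countType) (ar : S -> nat).
Implicit Types (s t u : term V ar) (sigma tau : V -> term V ar).

(** * Bisimilarity, substitution and variable occurrences *)

Lemma teq_refl t : teq t t.
Proof. by move: t; cofix CIH => -[x|f a]; constructor. Qed.

Lemma teq_sym s t : teq s t -> teq t s.
Proof.
move: s t; cofix CIH => s t [x|f a b ab]; constructor => i.
exact: CIH (ab i).
Qed.

Lemma teq_inv s t : teq s t ->
  match s with
  | TVar x => t = TVar x
  | TFun f a => exists2 b, t = TFun f b & forall i, teq (a i) (b i)
  end.
Proof. by case=> [x|f a b ab] //; exists b. Qed.

Lemma teq_trans s t u : teq s t -> teq t u -> teq s u.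
Proof.
move: s t u; cofix CIH => s t u [x|f a b ab] /teq_inv => [->|]; first by constructor.
case=> c -> bc; constructor => i; exact: CIH (ab i) (bc i).
Qed.

Lemma subst_unfold sigma t :
  subst sigma t = match t with
                  | TVar x => sigma x
                  | TFun f a => TFun f (fun i => subst sigma (a i))
                  end.
Proof.
have {1}-> : subst sigma t =
    match subst sigma t with TVar x => TVar x | TFun f a => TFun f a end.
  by case: (subst sigma t).
by case: t => [x|f a] //=; case: (sigma x).
Qed.

Lemma occurs_fun f (a : 'I_(ar f) -> term V ar) i x :
  occurs x (a i) -> occurs x (TFun f a).
Proof. by case=> p xp; exists (val i :: p); constructor. Qed.

Lemma occurs_inv x t : occurs x t ->
  match t with
  | TVar y => x = y
  | TFun f a => exists i, occurs x (a i)
  end.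
Proof. by case=> p [y|f a i q y yq] //; exists i, q. Qed.

(** Makes occurrence in a finite term decidable, so that substitutions can later be defined by cases
    on it. *)
Lemma finite_vars t : finite_term t ->
  exists vs : seq V, forall x, x \in vs <-> occurs x t.
Proof.
elim=> [y|f a _ /fin_all_exists [vs vsP]].
  exists [:: y] => x; rewrite inE; split=> [/eqP->|/occurs_inv ->]; last exact: eqxx.
  by exists [::]; constructor.
exists (flatten [seq vs i | i <- enum 'I_(ar f)]) => x; split.
  by case/flatten_mapP=> i _ /vsP; apply: occurs_fun.
case/occurs_inv=> i /vsP xi; apply/flatten_mapP; exists i => //.
by rewrite mem_enum.
Qed.

Lemma subst_agree sigma tau t : finite_term t ->
  (forall x, occurs x t -> sigma x = tau x) ->
  teq (subst sigma t) (subst tau t).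
Proof.
elim=> [y|f a _ IH] eq_st; rewrite (subst_unfold sigma) (subst_unfold tau).
  by rewrite eq_st; [apply: teq_refl|exists [::]; constructor].
by constructor => i; apply: IH => x /occurs_fun; apply: eq_st.
Qed.

Lemma linear_fun f (a : 'I_(ar f) -> term V ar) i :
  linear_term (TFun f a) -> linear_term (a i).
Proof. by move=> lin x p q xp xq; have [] := lin _ _ _ (var_at_fun xp) (var_at_fun xq). Qed.

Lemma linear_disjoint f (a : 'I_(ar f) -> term V ar) i j x :
  linear_term (TFun f a) -> occurs x (a i) -> occurs x (a j) -> i = j.
Proof.
move=> lin [p xp] [q xq]; apply: val_inj.
by have [] := lin _ _ _ (var_at_fun xp) (var_at_fun xq).
Qed.

(** By linearity a variable occurs in at most one argument [a i], and that argument decides which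
    [tau i] to follow. *)
Lemma linear_glue f (a : 'I_(ar f) -> term V ar)
    (tau : 'I_(ar f) -> V -> term V ar) :
  (forall i, finite_term (a i)) -> linear_term (TFun f a) ->
  exists sigma, forall i x, occurs x (a i) -> sigma x = tau i x.
Proof.
move=> fin_a lin.
have [vs vsP] := fin_all_exists (fun i => finite_vars (fin_a i)).
(* The value [TVar x] is an arbitrary default for variables that occur in no argument. *)
exists (fun x => if [pick i | x \in vs i] is Some i then tau i x else TVar x).
move=> i x xi; case: pickP => [j /vsP xj|/(_ i)]; first by rewrite (linear_disjoint lin xi xj).
by move/vsP: xi => ->.
Qed.

(** * Reflexive transitive closure modulo bisimilarity *)

Section Star.
Variable red : term V ar -> term V ar -> Prop.

Lemma star_teqr s t u : star red s t -> teq t u -> star red s u.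
Proof.
elim=> [s1 t1 st tu|s1 t1 u1 st _ IH tu]; first exact: star_refl (teq_trans st tu).
exact: star_step st (IH tu).
Qed.

Hypothesis red_teql : forall s s' t, teq s s' -> red s t -> red s' t.

Lemma star_teql s s' t : teq s s' -> star red s t -> star red s' t.
Proof.
move=> ss' st; case: st ss' => [s1 t1 st|s1 t1 u1 st tu] ss'.
  exact: star_refl (teq_trans (teq_sym ss') st).
exact: star_step (red_teql ss' st) tu.
Qed.

Lemma star_trans s t u : star red s t -> star red t u -> star red s u.
Proof.
elim=> [s1 t1 st tu|s1 t1 u1 st _ IH tu]; first exact: star_teql (teq_sym st) tu.
exact: star_step st (IH tu).
Qed.

End Star.

(** * Finite reductions below a function symbol *)

Section Steps.
Variable R : trs V ar.

Lemma step_teql s s' t : teq s s' -> step R s t -> step R s' t.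
Proof.
move=> ss' st; elim: st s' ss' => [rho sigma s1 t1 Rrho s1E t1E|f a b i _ IH ab] s' ss'.
  exact: step_root Rrho (teq_trans (teq_sym ss') s1E) t1E.
have [c -> ac] := teq_inv ss'.
apply: (step_arg (i := i)) => [|j ji]; first exact: IH.
exact: teq_trans (teq_sym (ac j)) (ab j ji).
Qed.

Lemma star_arg f (a b : 'I_(ar f) -> term V ar) i :
  star (step R) (a i) (b i) -> (forall j, j != i -> teq (a j) (b j)) ->
  star (step R) (TFun f a) (TFun f b).
Proof.
move Es: (a i) => s; move Et: (b i) => t st.
elim: st a b Es Et => [s1 t1 st|s1 t1 u1 st _ IH] a b Es Et ab.
  apply: star_refl; constructor=> j.
  by have [->|/ab //] := eqVneq j i; rewrite Es Et.
pose c j := if j == i then t1 else a j.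
apply: (@star_step _ _ _ _ _ (TFun f c)).
  apply: (step_arg (i := i)) => [|j ji]; rewrite /c; first by rewrite eqxx Es.
  by rewrite (negPf ji); apply: teq_refl.
by apply: IH => [||j ji]; rewrite /c ?eqxx // (negPf ji); apply: ab.
Qed.

Lemma star_args f (a b : 'I_(ar f) -> term V ar) :
  (forall i, star (step R) (a i) (b i)) -> star (step R) (TFun f a) (TFun f b).
Proof.
(* In [c r] exactly the arguments indexed by [r] are already reduced; the list grows one index at a
   time until it enumerates all of them. *)
move=> ab; pose c (r : seq 'I_(ar f)) j := if j \in r then b j else a j.
have red_c r : star (step R) (TFun f a) (TFun f (c r)).
  elim: r => [|i r IH]; first by apply/star_refl/teq_refl.
  apply: (star_trans step_teql) IH _; apply: (@star_arg _ _ _ i).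
    rewrite /c mem_head; case: ifP => _ //; exact/star_refl/teq_refl.
  by move=> j ji; rewrite /c inE (negPf ji); apply: teq_refl.
apply: star_teqr (red_c (enum 'I_(ar f))) _; constructor => j.
by rewrite /c mem_enum; apply: teq_refl.
Qed.

(** * Chains, lifts and the exposure of patterns *)

Section Transfinite.
Variables (W : Type) (lt : W -> W -> Prop).
Hypothesis lt_trans : forall a b c, lt a b -> lt b c -> lt a c.

Local Notation Lift := (Defs.lift (step R) lt).
Local Notation Chain := (chain (step R) lt Lift).
Local Notation Mred := (mred (step R) lt).

Lemma chain_starl gamma m s t u :
  star (step R) s t -> Chain gamma m t u -> Chain gamma m s u.
Proof.
move=> st tu; case: tu st => [s1 t1 s1t1|n d s1 s2 t2 t1 dg s12 L2 c] st.
  by apply/chain_0/(star_trans step_teql st).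
exact: chain_S dg (star_trans step_teql st s12) L2 c.
Qed.

Lemma chain_trans gamma m n s t u :
  Chain gamma m s t -> Chain gamma n t u -> Chain gamma (m + n) s u.
Proof.
elim=> [s1 t1 st|k d s1 s2 t2 t1 dg s12 L2 _ IH] tu; first exact: chain_starl st tu.
exact: chain_S dg s12 L2 (IH tu).
Qed.

Lemma chain_lt epsilon delta m s t :
  lt epsilon delta -> Chain epsilon m s t -> Chain delta m s t.
Proof.
move=> ed; elim=> [s1 t1 st|k d s1 s2 t2 t1 de s12 L2 _ IH]; first exact: chain_0.
exact: chain_S (lt_trans de ed) s12 L2 IH.
Qed.

Lemma lift_mred gamma s t : Lift gamma s t -> Mred gamma s t.
Proof. by apply: Defs.split; apply/chain_0/star_refl/teq_refl. Qed.

Lemma chain_mred gamma m s t u :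
  Chain gamma m s t -> Mred gamma t u -> Mred gamma s u.
Proof. by move=> st [n t' tt' L]; apply: Defs.split (chain_trans st tt') L. Qed.

Lemma lift_inv gamma s t : Lift gamma s t ->
  match t with
  | TVar x => s = TVar x
  | TFun f b => exists2 a, s = TFun f a & forall i, Mred gamma (a i) (b i)
  end.
Proof. by case=> [//|g f a b ab]; exists a. Qed.

(** Coinduction principle that settles guardedness once and for all: the chains consist of genuine
    lifts, so the corecursive call is needed only for the last lift of each (split). *)
Lemma lift_coind gamma (X : term V ar -> term V ar -> Prop) :
  (forall s t, X s t ->
    match t with
    | TVar x => s = TVar x
    | TFun f b => exists2 a, s = TFun f a &
        forall i, exists m u, Chain gamma m (a i) u /\ X u (b i)
    end) ->
  forall s t, X s t -> Lift gamma s t.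
Proof.
move=> unfoldX; cofix CIH => s t /unfoldX; case: t => [x ->|f b [a -> ab]].
  exact: lift_var.
apply: lift_fun => i; case: (ab i) => m [u [au ub]].
exact: Defs.split au (CIH _ _ ub).
Qed.

Lemma lift_teqr gamma s t t' : Lift gamma s t -> teq t t' -> Lift gamma s t'.
Proof.
move=> st tt'; apply: (@lift_coind gamma (fun s t' => exists2 t, Lift gamma s t & teq t t'));
  last by exists t.
move=> {s t t' st tt'} s t' [t] + /[dup] tt' /teq_inv.
case: t tt' => [x _ /lift_inv -> -> //|f b _ /lift_inv [a -> ab] [b' -> bb']].
exists a => // i; have [m u au ub] := ab i.
by exists m, u; split=> //; exists (b i).
Qed.

Lemma mred_teqr gamma s t t' : Mred gamma s t -> teq t t' -> Mred gamma s t'.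
Proof. by move=> [m u su ut] tt'; apply: Defs.split su (lift_teqr ut tt'). Qed.

(** Here [t] may be infinite, as right-hand sides are, so the argument is coinductive; repeated
    variables are harmless. *)
Lemma mred_subst gamma sigma tau t :
  (forall x, occurs x t -> Mred gamma (sigma x) (tau x)) ->
  Mred gamma (subst sigma t) (subst tau t).
Proof.
move=> st.
(* Either a variable of [t] has been passed and a given lift is being followed, or both sides are
   still instances of the same subterm with a function symbol at its root. *)
pose X s u := Lift gamma s u \/
  exists f (a : 'I_(ar f) -> term V ar),
    [/\ forall i x, occurs x (a i) -> Mred gamma (sigma x) (tau x),
        s = TFun f (fun i => subst sigma (a i)) &
        u = TFun f (fun i => subst tau (a i))].
have mredX r : (forall x, occurs x r -> Mred gamma (sigma x) (tau x)) ->
    exists m s, Chain gamma m (subst sigma r) s /\ X s (subst tau r).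
  case: r => [y|f a] Hr; rewrite !subst_unfold.
    have [|m s ys sy] := Hr y; first by exists [::]; constructor.
    by exists m, s; split=> //; left.
  exists 0, (TFun f (fun i => subst sigma (a i))); split.
    exact/chain_0/star_refl/teq_refl.
  by right; exists f, a; split=> // i x /occurs_fun; apply: Hr.
have [m [s [ts su]]] := mredX t st.
apply: Defs.split ts _; apply: lift_coind su => {m s t st} s u.
case=> [|[f [a [Ha -> ->]]]].
  move/lift_inv; case: u => [//|f b [a -> ab]]; exists a => // i.
  by have [m u au ub] := ab i; exists m, u; split=> //; left.
by exists (fun i => subst sigma (a i)) => // i; apply: mredX => x; apply: Ha.
Qed.

(** Each lift at [epsilon] preserves the root and acts on every argument by a chain below [epsilon]
    followed by one lift at [epsilon]; since [epsilon] is below [delta], all of this fits into one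
    chain for [delta]. *)
Lemma star_lift_fun epsilon delta s f (b : 'I_(ar f) -> term V ar) :
  lt epsilon delta -> star (Lift epsilon) s (TFun f b) ->
  exists2 a, s = TFun f a & forall i, exists m, Chain delta m (a i) (b i).
Proof.
move=> ed; move Et: (TFun f b) => t st.
elim: st Et => [s1 t1 s1t1 Et|s1 t1 u1 L _ IH /IH [c Et cb]].
  move: s1t1 => /teq_sym; rewrite -Et => /teq_inv[a -> ba]; exists a => // i.
  by exists 0; apply/chain_0/star_refl/teq_sym.
move: L => /lift_inv; rewrite Et => -[a -> ac]; exists a => // i.
(* The successor counts the lift at [epsilon] that closes the first (split). *)
have [m u au uc] := ac i; have [n cbn] := cb i; exists (m + n.+1).
apply: chain_trans (chain_lt ed au) _.
exact: chain_S ed (star_refl _ (teq_refl _)) uc cbn.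
Qed.

Lemma mred_fun_expose delta s f (b : 'I_(ar f) -> term V ar) :
  property_P (step R) lt delta -> Mred delta s (TFun f b) ->
  exists2 a, star (step R) s (TFun f a) & forall i, Mred delta (a i) (b i).
Proof.
move=> Pd [m u /Pd [v [epsilon [ed sv vu]]] /lift_inv [c uE cb]].
move: vu; rewrite uE => /(star_lift_fun ed) [a vE ac].
exists a; first by rewrite -vE.
by move=> i; have [n acn] := ac i; apply: chain_mred acn (cb i).
Qed.

Lemma mred_pattern delta sigma l s :
  property_P (step R) lt delta -> finite_term l -> linear_term l ->
  Mred delta s (subst sigma l) ->
  exists2 tau, star (step R) s (subst tau l) &
    forall x, occurs x l -> Mred delta (tau x) (sigma x).
Proof.
move=> Pd fin_l; elim: fin_l s => [y|f a fin_a IH] s lin; rewrite subst_unfold.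
  (* A pattern that is a single variable matches [s] itself, and the value at other variables is
     irrelevant. *)
  move=> sy; exists (fun=> s) => [|x /occurs_inv -> //].
  by rewrite subst_unfold; apply/star_refl/teq_refl.
move=> /(mred_fun_expose Pd) [c sc ca].
have /fin_all_exists2 [tau' c_tau' tau'_sigma] i := IH i _ (linear_fun lin) (ca i).
have [tau tauE] := linear_glue tau' fin_a lin.
exists tau => [|x /occurs_inv [i xi]]; last by rewrite (tauE i x xi); apply: tau'_sigma.
rewrite subst_unfold; apply: (star_trans step_teql) sc _; apply: star_args => i.
apply: star_teqr (c_tau' i) _; apply: subst_agree (fin_a i) _ => x xi.
by rewrite (tauE i x xi).
Qed.

End Transfinite.
End Steps.
End Terms.

Theorem theorem3p11 (V S : countType) (ar : S -> nat) (R : trs V ar)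
  (R_left_linear : left_linear R)
  (W : Type) (lt : W -> W -> Prop) (lt_wo : well_order lt)
  (delta : W) (s t t' : term V ar) :
  property_P (step R) lt delta ->
  mred (step R) lt delta s t ->
  step R t t' ->
  exists s' : term V ar, star (step R) s s' /\ mred (step R) lt delta s' t'.
Proof.
move=> Pd st tt'; have lt_trans := wo_trans lt_wo.
(* Induction on the position of the redex, with [s] general because it changes at each descent into
   an argument. *)
elim: tt' s st => [rho sigma t1 t2 Rrho t1E t2E|f a b i _ IH ab] s st.
  have [tau s_tau tau_sigma] :=
    mred_pattern lt_trans Pd (@lhs_finite _ _ _ rho) (R_left_linear _ Rrho) (mred_teqr st t1E).
  exists (subst tau (rhs rho)); split.
    apply: (star_trans (@step_teql _ _ _ R)) s_tau _.
    apply: star_step (star_refl _ (teq_refl _)).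
    exact: step_root Rrho (teq_refl _) (teq_refl _).
  (* Every variable of the right-hand side occurs in the left-hand side, where [tau] and [sigma] are
     already related. *)
  apply: mred_teqr (teq_sym t2E); apply: mred_subst => x /rhs_vars.
  exact: tau_sigma.
have [c sc ca] := mred_fun_expose lt_trans Pd st.
have [d [cd db]] := IH _ (ca i).
pose c' j := if j == i then d else c j.
exists (TFun f c'); split.
  apply: (star_trans (@step_teql _ _ _ R)) sc _.
  by apply: (@star_arg _ _ _ _ _ _ _ i) => [|j ji]; rewrite /c' ?eqxx // (negPf ji); apply: teq_refl.
(* Argument [i] is settled by the induction hypothesis; the others are unchanged up to
   bisimilarity. *)
apply: lift_mred; apply: lift_fun => j; rewrite /c'.
have [->//|ji] := eqVneq j i.
exact: mred_teqr (ca j) (ab j ji).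
Qed.
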